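(* Let $a\in\mathbb{Z}_{\geq 1}$. For $m\in\mathbb{Z}_{\ge 2}$ and $0\le r\le m$ put $$f_{m,a}(r)=\frac{1}{(1+a)^r}\sum_{i=0}^{r}\binom{m}{i}a^i,\qquad r_a=\Big\lfloor\frac{am-(a-1)}{2a+1}\Big\rfloor+1 .$$ Then for all $m\in\mathbb{Z}_{\geq 2}\setminus\{3,\,2a+4,\,4a+5\}$, with additionally $m\neq 12$ in the case $a=1$, the sequence $\{f_{m,a}(r)\}_{r=0}^{m}$ attains its maximum value at $r=r_a$. *)

(* Defs.v *)
From mathcomp Require Import all_boot all_order all_algebra.
Set Implicit Arguments.
Unset Strict Implicit.
Unset Printing Implicit Defensive.
Import Order.TTheory GRing.Theory Num.Theory.
Local Open Scope ring_scope.

Definition f (m a r : nat) : rat :=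
  1 / (1 + a%:R) ^+ r * \sum_(0 <= i < r.+1) 'C(m, i)%:R * a%:R ^+ i.

(* For 1 <= a and 2 <= m we have a - 1 <= a * m, so neither truncated
   subtraction truncates, and %/ is the floor of the rational quotient. *)
Definition r_ (a m : nat) : nat :=
  ((a * m - (a - 1)) %/ (2 * a + 1)).+1.

(* Main.v *)
Require Import Defs.
From mathcomp Require Import all_boot all_order all_algebra.
From mathcomp Require Import zify ring lra.
Import Order.TTheory GRing.Theory Num.Theory.
Local Open Scope ring_scope.

(** Put [T k = 'C(m, k) a ^ k] and [S k = T 0 + ... + T (k - 1)]. Then
    [f m a (k - 1) <= f m a k] if and only if [a S k <= T k]. Iterating the
    partial sum operator on [T] gives nonnegative sequences [T, S, P, Q, ...]
    linked by a three-term relation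
      [(k - i) X_i k = E_i k X_(i+1) k + (i + 1) (a + 1) X_(i+2) k],
    [E_i] affine in [k] (its iteration is the continued fraction of [T k / S k]).
    Truncating it bounds [T k / S k] alternately from below and from above.
    Write [a m - (a - 1) = (2 a + 1) q + s] with [0 <= s <= 2 a]. Up to [k = q + 1]
    the first truncation gives [a S k <= T k], except when [k = q + 1] and
    [s = 0], where the third one is needed; this is where the
    exceptional values of [m] come from. At [k = q + 2] the second truncation
    gives [T k <= a S k], which propagates to larger [k] because there
    [T (k + 1) <= (a + 1) T k]. *)

Definition psum {R : nzRingType} (i : nat) (T : nat -> R) : nat -> R :=
  iter i (fun U k => \sum_(0 <= j < k) U j) T.

Lemma psum0 {R : nzRingType} (i : nat) (T : nat -> R) : psum i.+1 T 0%N = 0.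
Proof. by rewrite /psum /= big_geq. Qed.

Lemma psumS {R : nzRingType} (i : nat) (T : nat -> R) (k : nat) :
  psum i.+1 T k.+1 = psum i.+1 T k + psum i T k.
Proof. by rewrite /psum /= big_nat_recr. Qed.

Lemma psum_ge0 {R : numDomainType} (i : nat) (T : nat -> R) (k : nat) :
  (forall j, 0 <= T j) -> 0 <= psum i T k.
Proof.
move=> T_ge0; elim: i k => [|i IHi] k //.
by rewrite /psum /=; apply: sumr_ge0 => j _; apply: IHi.
Qed.

(** Double induction: the defect (left minus right side) at [(i.+1, k.+1)] is the sum of those at
    [(i.+1, k)] and [(i, k)]; for [i = 0] the recurrence of [T] replaces the latter. *)
Lemma psum_three_term {R : comNzRingType} (T : nat -> R) (x M : R) :
    (forall k, k.+1%:R * T k.+1 = x * (M - k%:R) * T k) ->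
  forall i k : nat, (k%:R - i%:R) * psum i T k =
    (x * (M - k%:R + 1) - (k%:R - 1) + i%:R * (x + 2)) * psum i.+1 T k
      + i.+1%:R * (x + 1) * psum i.+2 T k.
Proof.
move=> recT; elim=> [|i IHi]; elim=> [|k IHk].
- by rewrite !psum0 subrr !mul0r !mulr0 addr0.
- have psT j : psum 0 T j = T j by [].
  have recTk := recT k; move: recTk IHk; rewrite !psumS !psT -!natr1 => recTk IHk.
  apply/eqP; rewrite -subr_eq0; apply/eqP.
  set A := (X in _ = X) in IHk; set B := (X in _ = X) in recTk.
  have -> : 0 = ((k%:R - 0%:R) * T k - A) + ((k%:R + 1) * T k.+1 - B).
    by rewrite IHk recTk !subrr addr0.
  rewrite /A /B; ring.
- by rewrite !psum0 !mulr0 addr0.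
- have IHik := IHi k; move: IHk IHik; rewrite !psumS -!natr1 => IHk IHik.
  apply/eqP; rewrite -subr_eq0; apply/eqP.
  set A := (X in _ = X) in IHk; set B := (X in _ = X) in IHik.
  have -> : 0 = ((k%:R - (i%:R + 1)) * psum i.+1 T k - A)
              + ((k%:R - i%:R) * psum i T k - B).
    by rewrite IHk IHik !subrr addr0.
  rewrite /A /B; ring.
Qed.

Lemma psum_le_first {R : realFieldType} (T : nat -> R) (x M : R) (k : nat) :
    (forall k, k.+1%:R * T k.+1 = x * (M - k%:R) * T k) ->
    (forall k, 0 <= T k) -> 0 <= x -> (2 * x + 1) * k%:R + x <= x * M ->
  x * psum 1 T k.+1 <= T k.+1.
Proof.
move=> recT T_ge0 x_ge0 le_k.
have := psum_three_term T x M recT 0 k.+1.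
have := psum_ge0 1 T k.+1 T_ge0; have := psum_ge0 2 T k.+1 T_ge0.
rewrite -[psum 0 T _]/(T _); move: (psum _ _ _) (psum _ _ _) => P S P0 S0 E.
have k0 : 0 <= k%:R :> R by [].
rewrite -(ler_pM2l (ltr0Sn _ k)) -natr1.
rewrite -natr1 in E; nra.
Qed.

(** Here [x * M] is one below the threshold of [psum_le_first], so the [psum 2] term must make up
    for exactly one copy of [psum 1]. *)
Lemma psum_le_third {R : realFieldType} (T : nat -> R) (x M : R) (k : nat) :
    (forall k, k.+1%:R * T k.+1 = x * (M - k%:R) * T k) ->
    (forall k, 0 <= T k) -> 0 <= x -> (0 < k)%N ->
    x * M = (2 * x + 1) * k%:R + x - 1 ->
    2 * (k%:R - 1) * (x + 1) <= (k%:R - 1 - 2 * x) * (x * k%:R + 3 * x + 3) ->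
  x * psum 1 T k.+1 <= T k.+1.
Proof.
move=> recT T_ge0 x_ge0 k_gt0 eq_k le_k.
have := psum_three_term T x M recT 0 k.+1.
have := psum_three_term T x M recT 1 k.+1.
have := psum_three_term T x M recT 2 k.+1.
have := psum_ge0 4 T k.+1 T_ge0; have := psum_ge0 3 T k.+1 T_ge0.
have := psum_ge0 2 T k.+1 T_ge0; have := psum_ge0 1 T k.+1 T_ge0.
rewrite -[psum 0 T _]/(T _).
move: (psum 1 _ _) (psum 2 _ _) (psum 3 _ _) (psum 4 _ _) => S P Q V.
move=> S0 P0 Q0 V0; rewrite -natr1.
have k0 : 0 < k%:R :> R by rewrite ltr0n.
have k1 : 0 < k%:R + 1 :> R by rewrite ltr_wpDl.
rewrite -(ler_pM2l k1).
move: (k%:R) k0 k1 eq_k le_k => y y0 y1 eq_k le_k.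
have -> : x * (M - (y + 1) + 1) = (x + 1) * y + x - 1.
  by rewrite !mulrDr eq_k; ring.
move=> E2 E1 E0.
(* [V >= 0] in [E2] bounds [Q] by [P]; inserted in [E1], this bounds [S] by [P], with the
   coefficient that [le_k] controls. *)
have le_SP : S <= (x + 1) * P.
  have E2_gt0 : 0 < x * y + 3 * x + 3 by nra.
  have le_QP : (x * y + 3 * x + 3) * Q <= (y - 1) * P by nra.
  rewrite -(ler_pM2l (mulr_gt0 E2_gt0 y0)).
  have : 2 * (x + 1) * ((x * y + 3 * x + 3) * Q) <= 2 * (x + 1) * ((y - 1) * P).
    by apply: ler_wpM2l => //; lra.
  have := ler_wpM2r P0 le_k.
  have : (x * y + 3 * x + 3) * (y * S) =
     (x * y + 3 * x + 3) * ((x * y + 2 * x + 1) * P + 2 * (x + 1) * Q).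
    by congr (_ * _); lra.
  lra.
lra.
Qed.

Lemma psum_ge_second {R : realFieldType} (T : nat -> R) (x M : R) (k : nat) :
    (forall k, k.+1%:R * T k.+1 = x * (M - k%:R) * T k) ->
    (forall k, 0 <= T k) -> 1 <= x -> (0 < k)%N ->
    (2 * x + 1) * k%:R - x - 2 <= x * M <= (2 * x + 1) * k%:R + x - 2 ->
  T k.+1 <= x * psum 1 T k.+1.
Proof.
move=> recT T_ge0 x_ge1 k_gt0 /andP[le_k ge_k].
have := psum_three_term T x M recT 0 k.+1.
have := psum_three_term T x M recT 1 k.+1.
have := psum_ge0 3 T k.+1 T_ge0.
have := psum_ge0 2 T k.+1 T_ge0; have := psum_ge0 1 T k.+1 T_ge0.
rewrite -[psum 0 T _]/(T _).
move: (psum 1 _ _) (psum 2 _ _) (psum 3 _ _) => S P Q.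
move=> S0 P0 Q0; rewrite -natr1.
have k0 : 1 <= k%:R :> R by rewrite ler1n.
have k1 : 0 < k%:R + 1 :> R by lra.
rewrite -(ler_pM2l k1).
move: (k%:R) k0 k1 le_k ge_k => y y0 y1 le_k ge_k.
(* [d] is the shortfall of [x * M] from the threshold of [psum_le_first]; by [E0] the claim becomes
   [(x + 1) * P <= d * S]. *)
pose d := (2 * x + 1) * y + x - x * M.
have -> : x * (M - (y + 1) + 1) = (x + 1) * y + x - d by rewrite /d; ring.
have [d2 dx] : 2 <= d /\ d <= 2 * x + 2 by rewrite /d; lra.
move: d d2 dx => d d2 dx E1 E0.
have E1_gt0 : 0 < x * y + 2 * x + 2 - d by nra.
have le_PS : (x + 1) * P <= d * S.
  rewrite -(ler_pM2l E1_gt0).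
  have : (x + 1) * ((x * y + 2 * x + 2 - d) * P) <= (x + 1) * (y * S).
    by apply: ler_wpM2l; nra.
  (* The right side is concave in [d], so the endpoints [2] and [2 * x + 2] decide. *)
  have : (x + 1) * y <= d * (x * y + 2 * x + 2 - d) by nra.
  move/(ler_wpM2r S0); lra.
lra.
Qed.

Lemma psum_ge_step {R : realFieldType} (T : nat -> R) (x M : R) (k : nat) :
    (forall k, k.+1%:R * T k.+1 = x * (M - k%:R) * T k) ->
    (forall k, 0 <= T k) -> x * (M - k%:R) <= (x + 1) * k.+1%:R ->
  T k <= x * psum 1 T k -> T k.+1 <= x * psum 1 T k.+1.
Proof.
move=> recT T_ge0 le_k le_T.
apply: (@le_trans _ _ ((x + 1) * T k)).
  rewrite -(ler_pM2l (ltr0Sn _ k)) recT mulrA; apply: ler_wpM2r => //.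
  by rewrite [leRHS]mulrC.
by rewrite psumS -[psum 0 T k]/(T k); lra.
Qed.

Definition bterm (m a k : nat) : rat := 'C(m, k)%:R * a%:R ^+ k.

Lemma bterm_ge0 (m a k : nat) : 0 <= bterm m a k.
Proof. by rewrite mulr_ge0 ?exprn_ge0. Qed.

Lemma bterm_rec (m a k : nat) :
  k.+1%:R * bterm m a k.+1 = a%:R * (m%:R - k%:R) * bterm m a k.
Proof.
rewrite /bterm exprS mulrA -natrM mul_bin_left natrM.
(* For [k > m] the rational [m - k] differs from the truncated one, but the binomial vanishes. *)
have [le_km|lt_mk] := leqP k m; first by rewrite natrB //; ring.
by rewrite bin_small // !(mulr0, mul0r).
Qed.

Lemma fE (m a r : nat) : f m a r = psum 1 (bterm m a) r.+1 / (1 + a%:R) ^+ r.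
Proof. by rewrite /f mul1r mulrC. Qed.

Lemma fSE (m a r : nat) : f m a r.+1 =
  (psum 1 (bterm m a) r.+1 + bterm m a r.+1) / (1 + a%:R) / (1 + a%:R) ^+ r.
Proof. by rewrite fE psumS exprS invfM mulrA. Qed.

Lemma le_fS (m a r : nat) :
  (f m a r <= f m a r.+1) = (a%:R * psum 1 (bterm m a) r.+1 <= bterm m a r.+1).
Proof.
have a1 : 0 < 1 + a%:R :> rat by rewrite ltr_pwDl.
rewrite fSE fE ler_pM2r ?invr_gt0 ?exprn_gt0 // ler_pdivlMr //.
by rewrite mulrDr mulr1 lerD2l mulrC.
Qed.

Lemma ge_fS (m a r : nat) :
  (f m a r.+1 <= f m a r) = (bterm m a r.+1 <= a%:R * psum 1 (bterm m a) r.+1).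
Proof.
have a1 : 0 < 1 + a%:R :> rat by rewrite ltr_pwDl.
rewrite fSE fE ler_pM2r ?invr_gt0 ?exprn_gt0 // ler_pdivrMr //.
by rewrite mulrDr mulr1 lerD2l mulrC.
Qed.

(* The last hypothesis of [psum_le_third] at [k = t x + 1] with [t = u + 3]. *)
Lemma psum_le_third_cond {R : realFieldType} (x u : R) :
    1 <= x -> 0 <= u -> 2 <= x \/ 1 <= u ->
  2 * ((u + 3) * x + 1 - 1) * (x + 1) <=
  ((u + 3) * x + 1 - 1 - 2 * x) * (x * ((u + 3) * x + 1) + 3 * x + 3).
Proof.
move=> x_ge1 u_ge0 xu; rewrite -subr_ge0.
rewrite [leRHS](_ : _ = x * ((x * u) ^+ 2 + 4 * (x * (x * u)) + 2 * (x * u) + u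
                             + (3 * x ^+ 2 - 2 * x - 3))); last by ring.
apply: mulr_ge0; first by lra.
have xu_ge : u <= x * u by rewrite ler_peMl.
have xxu_ge : x * u <= x * (x * u) by rewrite ler_peMl //; lra.
have := sqr_ge0 (x * u).
(* [3 * x ^+ 2 - 2 * x - 3] is positive for [x >= 2] but equals [-2] at [x = 1], where the terms in
   [u] compensate. *)
by case: xu => [x_ge2|u_ge1]; nra.
Qed.

(* The exceptions [m = 3, 2 a + 4, 4 a + 5] are [t = 0, 1, 2], and [m = 12] is
   [t = 3] for [a = 1]. *)
Lemma remainder0_param (a m q : nat) : (0 < a)%N -> (1 < m)%N ->
    (a * m + 1 = q * (2 * a + 1) + a)%N ->
  exists t, q = (t * a + 1)%N /\ m = (2 * (t * a) + t + 3)%N.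
Proof.
move=> a_gt0 m_gt1 Em.
have q_gt0 : (0 < q)%N by case: q Em => // Em; nia.
(* Over the integers the equation reads [a * (m - 2 * q - 1) = q - 1], so [t] is [m - 2 * q - 1]. *)
have le_qm : (2 * q + 1 <= m)%N.
  rewrite leqNgt; apply/negP => lt_mq.
  have /(leq_mul (leqnn a)) : (m <= 2 * q)%N by lia.
  by nia.
exists (m - (2 * q + 1))%N; have [t Et] : exists t, m = (t + (2 * q + 1))%N.
  by exists (m - (2 * q + 1))%N; lia.
by rewrite {}Et in Em *; rewrite addnK; nia.
Qed.

Theorem theorem1p1 (a m : nat) (a_ge1 : (1 <= a)%N) (m_ge2 : (2 <= m)%N)
    (m_neq3 : m <> 3%N) (m_neq2a4 : m <> (2 * a + 4)%N)
    (m_neq4a5 : m <> (4 * a + 5)%N) (m_neq12 : a = 1%N -> m <> 12%N) :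
  (r_ a m <= m)%N /\ (forall r : nat, (r <= m)%N -> f m a r <= f m a (r_ a m)).
Proof.
rewrite /r_; set q := (_ %/ _)%N; set s := ((a * m - (a - 1)) %% (2 * a + 1))%N.
have s_le : (s <= 2 * a)%N by rewrite -ltnS -[(2 * a).+1]addn1 ltn_mod addn1.
(* The division identity, rearranged to avoid truncated subtraction. *)
have Em : (a * m + 1 = q * (2 * a + 1) + s + a)%N.
  rewrite -divn_eq; nia.
clearbody q s.
have recT := bterm_rec m a; have T_ge0 := bterm_ge0 m a.
have x_ge1 : 1 <= a%:R :> rat by rewrite ler1n.
have s_ler : s%:R <= 2 * a%:R :> rat by rewrite -natrM ler_nat.
have s_ge0 : 0 <= s%:R :> rat by [].
have EM : a%:R * m%:R = (2 * a%:R + 1) * q%:R + s%:R + a%:R - 1 :> rat.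
  have := congr1 (fun n => n%:R : rat) Em; rewrite !natrD !natrM natrD natrM; lra.
split.
  rewrite ltnNge; apply/negP => le_mq.
  have := leq_mul le_mq (leqnn (2 * a + 1)); nia.
have up k : (k <= q)%N -> f m a k <= f m a k.+1.
  rewrite le_fS => le_kq.
  have [/andP[/eqP kq s0]|gt_kq] := boolP ((k == q) && (s == 0)%N).
    rewrite kq; rewrite (eqP s0) ?addn0 in EM Em.
    have [t [Eq Emt]] := remainder0_param a m q a_ge1 m_ge2 Em.
    have t_ge3 : (3 <= t)%N by case: t Eq Emt => [|[|[|]]] // Eq Emt; lia.
    have at_big : (a = 1 -> 4 <= t)%N by move=> a1; have := m_neq12 a1; lia.
    apply: (psum_le_third _ _ m%:R) => //.
      by rewrite Eq addn1.
      by rewrite EM addr0.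
    rewrite Eq natrD natrM -[t](subnK t_ge3) natrD; apply: psum_le_third_cond => //.
    have [a1|a_ge2] : (a = 1 \/ 2 <= a)%N by lia.
      by right; rewrite ler1n subn_gt0 at_big.
    by left; rewrite ler_nat.
  apply: (psum_le_first _ _ m%:R) => //.
  rewrite EM; have [kq|lt_kq] : k = q \/ (k < q)%N by lia.
    have : 1 <= s%:R :> rat by rewrite ler1n lt0n; move: gt_kq; rewrite kq eqxx.
    by rewrite kq; lra.
  have : k.+1%:R <= q%:R :> rat by rewrite ler_nat.
  by rewrite -natr1; nra.
have down k : (q < k)%N -> f m a k.+1 <= f m a k.
  rewrite ge_fS; elim: k => // k IHk; rewrite ltnS leq_eqVlt => /orP[/eqP <-|lt_qk].
    (* At [k = q.+1] the bounds [0 <= s <= 2 * a] are exactly the range required of [x * M]. *)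
    apply: (psum_ge_second _ _ m%:R) => //.
    rewrite EM -natr1; lra.
  apply: (psum_ge_step _ _ m%:R) => //; last exact: IHk.
  have : q.+1%:R <= k%:R :> rat by rewrite ler_nat.
  rewrite mulrBr EM -!natr1; nra.
move=> r _; have [le_rq|lt_qr] := leqP r q.+1.
  elim: {r}(q.+1 - r)%N {-2}r (erefl (q.+1 - r)%N) le_rq => [|n IHn] r Er le_rq.
    by have -> : r = q.+1 by lia.
  apply: le_trans (up r _) (IHn r.+1 _ _); lia.
elim: r lt_qr => // r IHr; rewrite ltnS leq_eqVlt => /orP[/eqP <-|lt_qr].
  exact: down.
exact: le_trans (down r (ltnW lt_qr)) (IHr lt_qr).
Qed.
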